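(* Among all bases $\beta \ge 2$, at least $99.3\%$ of them admit an interesting reversed sum-product pair; that is, $$\liminf_{N\to\infty} \frac{1}{N}\,\bigl|\{2 \le \beta \le N : \text{there exists an interesting reversed sum-product pair for the base } \beta\}\bigr| \ \ge\ 0.993.$$
   Context: A base-$\beta$ representation of a positive integer is canonical if it has no leading zero. A pair of positive integers $a \le b$ is a reversed sum-product pair for the base $\beta$ if the canonical base-$\beta$ representations of $a+b$ and $ab$ are the reverse of each other as digit strings (in particular they have the same number of digits). A reversed sum-product pair $(a,b)$ for the base $\beta$ is called interesting if it is neither $(2,2)$ nor $(\beta-1,\beta-1)$. *)

(* Defs.v *)
From mathcomp Require Import all_boot all_order all_algebra.
From mathcomp Require Import boolp reals ereal sequences.

Set Implicit Arguments.
Unset Strict Implicit.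
Unset Printing Implicit Defensive.

(* Digit strings are written with the most significant digit first. *)
Definition digits_value (beta : nat) (ds : seq nat) : nat :=
  foldl (fun acc d => acc * beta + d) 0 ds.

Definition is_representation (beta : nat) (ds : seq nat) (n : nat) : Prop :=
  all (fun d => d < beta) ds /\ digits_value beta ds = n.

(* The default 0 of [head] means that the empty string is not canonical; it
   represents 0 only, so this is immaterial for positive integers. *)
Definition is_canonical_representation (beta : nat) (ds : seq nat) (n : nat) :
    Prop :=
  is_representation beta ds n /\ head 0 ds != 0.

Definition reversed_sum_product_pair (beta a b : nat) : Prop :=
  [/\ 0 < a, a <= b &
      exists2 ds : seq nat,
        is_canonical_representation beta ds (a + b) &
        is_canonical_representation beta (rev ds) (a * b)].

Definition interesting_pair (beta a b : nat) : Prop :=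
  [/\ reversed_sum_product_pair beta a b,
      (a, b) <> (2, 2) & (a, b) <> (beta - 1, beta - 1)].

Definition admits_interesting_pair (beta : nat) : Prop :=
  exists a b : nat, interesting_pair beta a b.

(* The number of bases beta with 2 <= beta <= N admitting an interesting pair. *)
Definition num_good_bases (N : nat) : nat :=
  count (fun beta => `[< admits_interesting_pair beta >]) (index_iota 2 N.+1).

(* Main.v *)
(* Fix a small [a] and look for [S = a + b] with [a * S = rev S + a ^ 2], where
   [rev] reverses base-[beta] digits. Writing the multiplication with carries
   and eliminating the outermost pair of digits, both digits are determined by
   the carries: they equal [(beta * w - k) / (a ^ 2 - 1)] with [w] and [k] at
   most [a ^ 2 - 1]. For large [beta] they lie in range, so the only condition
   is divisibility by [a ^ 2 - 1], and the existence of [S] depends only on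
   [beta] modulo [a ^ 2 - 1]; it is a reachability question between pairs of
   carries. The residues covered by [a = 2, 4, .., 18] leave 99918 uncovered
   classes modulo 14549535, a proportion of about 0.00687. *)

Require Import Defs.
From Stdlib Require Import ZArith.
From mathcomp Require Import all_boot all_order all_algebra.
From mathcomp Require Import boolp reals ereal sequences.
From mathcomp Require Import topology zify ssrZ.
Import Order.TTheory GRing.Theory Num.Theory.

Set Implicit Arguments.
Unset Strict Implicit.
Unset Printing Implicit Defensive.

Local Open Scope nat_scope.
(* [ssrint] takes the key [Z] for [int_scope]. *)
Delimit Scope Z_scope with Z.

(** * Values of digit strings *)

Lemma digits_value_foldl beta acc ds :
  foldl (fun v d => v * beta + d) acc ds =
  acc * beta ^ size ds + digits_value beta ds.
Proof.
rewrite /digits_value; elim: ds acc => [|d ds IHds] acc /=.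
  by rewrite muln1 addn0.
by rewrite IHds [in RHS]IHds mul0n add0n expnS mulnDl mulnA addnA.
Qed.

Lemma digits_value_cons beta d ds :
  digits_value beta (d :: ds) = d * beta ^ size ds + digits_value beta ds.
Proof. exact: (digits_value_foldl beta d). Qed.

Lemma digits_value_rcons beta ds d :
  digits_value beta (rcons ds d) = digits_value beta ds * beta + d.
Proof. by rewrite /digits_value -cats1 foldl_cat. Qed.

(** * Carries and digits in the equation for [S] *)

(* A block of digits inside [a * S = rev S + a ^ 2]: [p] is the carry coming in
   from the right and [q] the carry going out on the left. *)
Definition carry_solution (beta a p q : Z) (ds : seq nat) : Prop :=
  let b := Z.to_nat beta in
  all (fun d => d < b) ds /\
  (a * Z.of_nat (digits_value b ds) + p =
   Z.of_nat (digits_value b (rev ds)) + q * Z.of_nat (b ^ size ds))%Z.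

Definition carry_solvable (beta a p q : Z) : Prop :=
  exists ds, carry_solution beta a p q ds.

(** Add the units equation, [beta] times the inner one, and the leading equation times
    [beta ^ (size ds).+1]; the inner carries cancel. *)
Lemma carry_solution_wrap beta a p q p' q' x y ds :
  (0 <= x < beta)%Z -> (0 <= y < beta)%Z ->
  (a * y + p = x + beta * p')%Z -> (a * x + q' = y + beta * q)%Z ->
  carry_solution beta a p' q' ds ->
  carry_solution beta a p q (Z.to_nat x :: rcons ds (Z.to_nat y)).
Proof.
move=> [x_ge0 x_lt] [y_ge0 y_lt] lo hi.
rewrite /carry_solution => -[ds_lt dsE]; split.
  by rewrite /= all_rcons ds_lt; lia.
rewrite rev_cons rev_rcons /= !digits_value_cons !digits_value_rcons.
rewrite !size_rcons size_rev !expnS.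
have := Z2Nat.id _ x_ge0; have := Z2Nat.id _ y_ge0.
have : Z.of_nat (Z.to_nat beta) = beta by rewrite Z2Nat.id //; lia.
move: dsE; move: (Z.to_nat _) (Z.to_nat x) (Z.to_nat y) => b x' y'.
move: (digits_value _ ds) (digits_value _ (rev ds)) (b ^ size ds)%N => V W B.
move=> dsE bE yE xE; subst beta x y.
have := f_equal (Z.mul (Z.of_nat b)) dsE.
have := f_equal (Z.mul (Z.of_nat b * Z.of_nat B)) hi.
lia.
Qed.

Lemma mod_residue r beta w k q m : (0 < m)%Z -> (r = beta mod m)%Z ->
  (q = (r * w - k) mod m)%Z -> exists y, (beta * w - k - q = m * y)%Z.
Proof.
move=> m_gt0 -> ->.
exists ((beta / m) * w + ((beta mod m) * w - k) / m)%Z.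
have := Z.div_mod beta m; have := Z.div_mod ((beta mod m) * w - k) m.
nia.
Qed.

Lemma carry_solvable_eq beta a p : carry_solvable beta a p p.
Proof. by exists [::]; split=> //=; rewrite /digits_value /=; lia. Qed.

(** The core when the digit count is odd: a single digit [s] with [(a - 1) * s = beta * q - p]. *)
Lemma carry_solvable_middle beta a p q :
  (0 <= p < a)%Z -> (0 < q < a - 1)%Z -> (a < beta)%Z ->
  ((beta * q - p) mod (a - 1) = 0)%Z -> carry_solvable beta a p q.
Proof.
move=> pa qa a_lt /Z.mod_divide[|s sE]; first lia.
have s_ge0 : (0 <= s < beta)%Z by nia.
exists [:: Z.to_nat s]; split; first by rewrite /= andbT; lia.
by rewrite /digits_value /rev /= expn1; nia.
Qed.

Lemma digit_bound beta w k m y :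
  (0 < w < m)%Z -> (0 <= k <= m)%Z -> (m <= beta)%Z ->
  (beta * w - k = m * y)%Z -> (0 <= y < beta)%Z.
Proof.
move=> w_bd k_bd m_le yE.
have : (0 < m * (y + 1))%Z by nia.
have : (m * y < m * beta)%Z by nia.
nia.
Qed.

(** The two outer digit equations form a linear system in [x] and [y] of determinant [a ^ 2 - 1].
    Excluding the extreme values of [a * p' + q] excludes those of [a * q + p'] too, so both digits
    are in range. *)
Lemma carry_solvable_step beta a p q p' q' :
  (1 < a)%Z -> (a * a <= beta)%Z ->
  (0 <= p < a)%Z -> (0 <= q < a)%Z -> (0 <= p' < a)%Z -> (0 <= q' < a)%Z ->
  (0 < a * p' + q < a * a - 1)%Z ->
  (exists y, beta * (a * p' + q) - a * p - q' = (a * a - 1) * y)%Z ->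
  carry_solvable beta a p' q' -> carry_solvable beta a p q.
Proof.
move=> a_gt1 a_le pa qa p'a q'a wa [y yE] [ds dsP].
set x := (a * y + p - beta * p')%Z.
have xE : (beta * (a * q + p') - a * q' - p = (a * a - 1) * x)%Z by rewrite /x; nia.
have y_lt : (0 <= y < beta)%Z.
  by apply: (@digit_bound beta (a * p' + q) (a * p + q') (a * a - 1)); nia.
have x_lt : (0 <= x < beta)%Z.
  by apply: (@digit_bound beta (a * q + p') (a * q' + p) (a * a - 1)); nia.
by eexists; apply: (carry_solution_wrap x_lt y_lt _ _ dsP); rewrite /x; nia.
Qed.

(* The term [a ^ 2] acts as an initial carry [p = - a ^ 2]; [(p, q)] is the pair
   of carries left after removing the outermost digits [x] and [z + a]. *)
Lemma carry_solvable_admits (a beta : nat) p q :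
  1 < a -> a * a * a < beta -> (0 < p < Z.of_nat a)%Z -> (0 <= q < Z.of_nat a)%Z ->
  (exists z, Z.of_nat beta * (Z.of_nat a * p) + Z.of_nat a - q =
             (Z.of_nat a * Z.of_nat a - 1) * z)%Z ->
  carry_solvable (Z.of_nat beta) (Z.of_nat a) p q ->
  admits_interesting_pair beta.
Proof.
move=> a_gt1 a3_lt pa qa [z zE] [ds dsP].
have beta_gt0 : 0 < beta by lia.
have dbl_a_lt : 2 * a < beta.
  by apply: leq_ltn_trans a3_lt; rewrite leq_mul2r; nia.
have {a3_lt} a3_lt : (Z.of_nat a * Z.of_nat a * Z.of_nat a < Z.of_nat beta)%Z by lia.
set A := Z.of_nat a in pa qa zE dsP a3_lt; set B := Z.of_nat beta in zE dsP a3_lt.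
have A_gt1 : (1 < A)%Z by lia.
pose x := (A * z - B * p)%Z; pose y := (z + A)%Z.
have xE : (B * p + A * (A - q) = (A * A - 1) * x)%Z by rewrite /x; nia.
have x_gt0 : (0 < x)%Z by nia.
have yE : (y = A * x + q)%Z by rewrite /x /y; nia.
have y_gt0 : (0 < y)%Z by clear - yE A_gt1 x_gt0 qa; nia.
(* [(A ^ 2 - 1) * y = A * B * p + A ^ 3 - q] with [p <= A - 1], so [A ^ 3 < B] suffices. *)
have y_lt : (y < B)%Z.
  have m_gt0 : (0 < A * A - 1)%Z by nia.
  by apply/(Z.mul_lt_mono_pos_l _ _ _ m_gt0); rewrite /y; nia.
have [ds_lt dsE] : carry_solution B A (- (A * A)) 0
    (Z.to_nat x :: rcons ds (Z.to_nat y)).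
  by apply: carry_solution_wrap dsP; rewrite /x /y; nia.
move: ds_lt dsE; rewrite /B Nat2Z.id; set e := _ :: _ => e_lt eE.
(* As [2 * a < beta], this makes the subtraction of [a] exact and the second member larger than [a],
   which rules out both trivial pairs. *)
have e_ge : beta <= digits_value beta e.
  rewrite digits_value_cons size_rcons expnS.
  apply: leq_trans (leq_addr _ _).
  have x'_gt0 : 0 < Z.to_nat x by lia.
  by rewrite mulnCA leq_pmulr // muln_gt0 x'_gt0 expn_gt0 beta_gt0.
have prodE : a * (digits_value beta e - a) = digits_value beta (rev e).
  move: eE; rewrite mulnBr /A.
  by move: (digits_value _ e) (digits_value _ (rev e)) (beta ^ _) => V W P; clear; lia.
have e_head : head 0 e != 0 by rewrite /e /=; clear - x_gt0; lia.
have rev_e_head : head 0 (rev e) != 0.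
  by rewrite /e rev_cons rev_rcons /=; clear - y_gt0; lia.
clearbody e; clear - e_lt e_ge prodE e_head rev_e_head a_gt1 dbl_a_lt.
exists a, (digits_value beta e - a); split; [split; [lia|lia|]| |].
- exists e; split=> //; split=> //; first by lia.
    by rewrite all_rev.
- by case; lia.
- by case; lia.
Qed.

(** * Search over carry pairs *)

(* The nested conditionals, rather than [&&], keep call-by-value evaluation
   from exploring pruned branches. *)
Fixpoint carry_search (fuel a : nat) (r p q : Z) : bool :=
  let A := Z.of_nat a in let m := (A * A - 1)%Z in
  [|| (p =? q)%Z,
      [&& (0 <? q)%Z, (q <? A - 1)%Z & ((r * q - p) mod (A - 1) =? 0)%Z] |
      if fuel is k.+1 then
        has (fun i =>
          let p' := Z.of_nat i in
          let w := (A * p' + q)%Z in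
          let q' := ((r * w - A * p) mod m)%Z in
          if [&& (q' <? A)%Z, (0 <? w)%Z & (w <? m)%Z]
          then carry_search k a r p' q' else false) (iota 0 a)
      else false].

(* Since [a ^ 2 = 1] modulo [a ^ 2 - 1], [- a] plays the part of [a * p] for the
   initial carry [p = - a ^ 2]. *)
Definition pair_search (fuel a : nat) (r : Z) : bool :=
  let A := Z.of_nat a in
  has (fun i =>
    let p := Z.of_nat i in
    let q := ((r * (A * p) - - A) mod (A * A - 1))%Z in
    if (q <? A)%Z then carry_search fuel a r p q else false) (iota 1 a.-1).

(** Only soundness matters: running out of fuel merely leaves more residues uncovered. *)
Lemma carry_search_sound fuel a beta p q :
  1 < a -> (Z.of_nat a * Z.of_nat a <= beta)%Z ->
  (0 <= p < Z.of_nat a)%Z -> (0 <= q < Z.of_nat a)%Z ->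
  carry_search fuel a (beta mod (Z.of_nat a * Z.of_nat a - 1)) p q ->
  carry_solvable beta (Z.of_nat a) p q.
Proof.
move=> a_gt1 a_le; move mE: (_ * _ - 1)%Z => m.
have m_gt0 : (0 < m)%Z by nia.
have middle p' q' : (0 <= p' < Z.of_nat a)%Z ->
    [&& (0 <? q')%Z, (q' <? Z.of_nat a - 1)%Z &
        ((beta mod m * q' - p') mod (Z.of_nat a - 1) =? 0)%Z] ->
    carry_solvable beta (Z.of_nat a) p' q'.
  move=> pa' /and3P[/Z.ltb_lt q'_gt0 /Z.ltb_lt q'_lt /Z.eqb_eq].
  move=> /Z.mod_divide[|s sE]; first by lia.
  apply: carry_solvable_middle => //; first by nia.
  apply/Z.mod_divide; first by lia.
  (* [m = (a - 1) * (a + 1)], so [beta mod m] determines [beta] modulo [a - 1]. *)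
  exists (s + (beta / m) * (Z.of_nat a + 1) * q')%Z.
  by rewrite {1}(Z.div_mod beta m); nia.
elim: fuel p q => [|k IHk] p q pa qa /or3P[/Z.eqb_eq->|/middle|] //;
  try by [exact: carry_solvable_eq|exact].
move=> /hasP[i]; rewrite mem_iota mE => i_lt; cbv zeta.
case: ifP => // /and3P[/Z.ltb_lt q'_lt /Z.ltb_lt w_gt0 /Z.ltb_lt w_lt].
set q' := (_ mod m)%Z in q'_lt * => /IHk IH.
have [q'_ge0 _] : (0 <= q' < m)%Z := Z.mod_pos_bound _ _ m_gt0.
refine (@carry_solvable_step _ _ _ _ (Z.of_nat i) q' _ _ _ _ _ _ _ _ _) => //; try lia.
- by rewrite mE; apply: (mod_residue m_gt0 (erefl _)).
- by apply: IH; lia.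
Qed.

Lemma pair_search_sound fuel a beta :
  1 < a -> a * a * a < beta ->
  pair_search fuel a (Z.of_nat beta mod (Z.of_nat a * Z.of_nat a - 1)) ->
  admits_interesting_pair beta.
Proof.
move=> a_gt1 a3_lt /hasP[i]; rewrite mem_iota => i_bd; cbv zeta.
set q := (_ mod (_ * _ - 1))%Z; case: ifP => // /Z.ltb_lt q_lt.
have m_gt0 : (0 < Z.of_nat a * Z.of_nat a - 1)%Z by nia.
have [q_ge0 _] := Z.mod_pos_bound _ _ m_gt0 : (0 <= q < _)%Z.
move=> /carry_search_sound sol.
apply: (@carry_solvable_admits a beta (Z.of_nat i) q) => //; first by lia.
- have [z zE] := mod_residue m_gt0 (erefl _) (erefl q).
  by exists z; lia.
- by apply: sol; nia.
Qed.

(** * Sieving residue classes *)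

(* [L] lists the residues modulo [M] that may contain large exceptional bases. *)
Definition sieve_step (fuel : nat) (ML : Z * seq Z) (a : nat) : Z * seq Z :=
  let: (M, L) := ML in
  let m := (Z.of_nat a * Z.of_nat a - 1)%Z in
  let found := [seq pair_search fuel a (Z.of_nat r) | r <- iota 0 (Z.to_nat m)] in
  let M' := Z.lcm M m in
  let lifts := [seq (x + M * Z.of_nat i)%Z | i <- iota 0 (Z.to_nat (M' / M)), x <- L] in
  (M', [seq x <- lifts | ~~ nth false found (Z.to_nat (x mod m))]).

Definition covers_exceptions (bound : nat) (ML : Z * seq Z) : Prop :=
  (0 < ML.1)%Z /\
  forall beta, bound < beta -> ~ admits_interesting_pair beta ->
    (Z.of_nat beta mod ML.1)%Z \in ML.2.

(** Reduction modulo the lcm preserves residues modulo [M] and [m]: the first places the base among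
    the lifts, the second keeps it through the filter. *)
Lemma sieve_step_covers bound fuel a ML :
  1 < a -> a * a * a <= bound ->
  covers_exceptions bound ML -> covers_exceptions bound (sieve_step fuel ML a).
Proof.
case: ML => M L a_gt1 a3_le [/= M_gt0 coverL].
set m := (_ * _ - 1)%Z; have m_gt0 : (0 < m)%Z by rewrite /m; nia.
have lcm_gt0 : (0 < Z.lcm M m)%Z.
  have := Z.lcm_nonneg M m; have := Z.lcm_eq_0 M m; lia.
split=> //= beta beta_gt no_pair; set b := Z.of_nat beta.
have modM : ((b mod Z.lcm M m) mod M = b mod M)%Z.
  exact: Z.mod_mod_divide (Z.divide_lcm_l M m).
have modm : ((b mod Z.lcm M m) mod m = b mod m)%Z.
  exact: Z.mod_mod_divide (Z.divide_lcm_r M m).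
have [r_ge0 r_lt] := Z.mod_pos_bound b m m_gt0.
rewrite mem_filter modm; apply/andP; split.
  apply/negP; rewrite (nth_map 0) ?size_iota; last by lia.
  rewrite nth_iota; last by lia.
  rewrite Z2Nat.id // => found; apply: no_pair.
  by apply: (@pair_search_sound fuel a) found => //; lia.
have [x_ge0 x_lt] := Z.mod_pos_bound b _ lcm_gt0.
apply/allpairsP; exists (Z.to_nat ((b mod Z.lcm M m) / M), (b mod M)%Z) => /=.
have [c cE] := Z.divide_lcm_l M m.
have := Z.div_mod (b mod Z.lcm M m) M; rewrite modM => divE.
have [y_ge0 y_lt] := Z.mod_pos_bound b _ M_gt0.
have cM : (Z.lcm M m / M = c)%Z by rewrite cE Z.div_mul; lia.
split; [rewrite mem_iota cM|exact: coverL|]; last first.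
  by rewrite Z2Nat.id; nia.
set k := (_ / M)%Z in divE *; have : (0 <= k < c)%Z by nia.
lia.
Qed.

Lemma sieve_covers bound fuel s :
  all (fun a => (1 < a) && (a * a * a <= bound)) s ->
  covers_exceptions bound (foldl (sieve_step fuel) (1%Z, [:: 0%Z]) s).
Proof.
have : covers_exceptions bound (1%Z, [:: 0%Z]).
  by split=> //= beta _ _; rewrite Z.mod_1_r.
elim: s (1%Z, _) => [|a s IHs] //= ML MLP /andP[/andP[a_gt1 a3_le] s_ok].
by apply: IHs s_ok; apply: sieve_step_covers.
Qed.

(** * Counting and density *)

Lemma modn_Zto_nat n M : (0 < M)%Z ->
  n %% Z.to_nat M = Z.to_nat (Z.of_nat n mod M).
Proof.
move=> M_gt0; set m := Z.to_nat M.
have m_gt0 : 0 < m by lia.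
have n_lt := ltn_pmod n m_gt0; have n_eq := divn_eq n m.
rewrite -(@Z.mod_unique_pos _ _ (Z.of_nat (n %/ m)) (Z.of_nat (n %% m))).
- by rewrite Nat2Z.id.
- by lia.
- have -> : M = Z.of_nat m by lia.
  by rewrite {1}n_eq; move: (n %/ m) (n %% m); lia.
Qed.

Lemma count_residues_le (M q : nat) (L : seq nat) : 0 < M ->
  count (fun n => n %% M \in L) (iota 0 (q * M)) <= q * size L.
Proof.
move=> M_gt0; elim: q => [|q IHq] //.
rewrite !mulSn addnC iotaD count_cat addnC leq_add //.
rewrite -[0 + q * M]addn0 add0n iotaDl count_map.
rewrite (@eq_in_count _ _ (mem L)) => [|n]; last first.
  by rewrite mem_iota /= => n_lt; rewrite modnMDl modn_small.
rewrite -size_filter uniq_leq_size ?filter_uniq ?iota_uniq // => n.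
by rewrite mem_filter => /andP[].
Qed.

(** A base is good, at most [bound], or in a listed class; the [1] makes up for bases starting at
    2. *)
Lemma num_good_bases_ge bound M L N : covers_exceptions bound (M, L) ->
  N <= num_good_bases N + bound + 1 + (N %/ Z.to_nat M).+1 * size L.
Proof.
move=> [/= M_gt0 coverL]; case: N => [|N] //.
set m := Z.to_nat M; have m_gt0 : 0 < m by lia.
pose exc n := n %% m \in [seq Z.to_nat x | x <- L].
pose good n := `[< admits_interesting_pair n >].
have bad_le : count (predC good) (index_iota 2 N.+2) <=
    count (fun n => n <= bound) (index_iota 2 N.+2) + count exc (index_iota 2 N.+2).
  rewrite -count_predUI; apply: leq_trans (leq_addr _ _).
  apply: sub_count => n /= /asboolPn no_pair.
  case: leqP => //= n_gt.
  rewrite /exc modn_Zto_nat //.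
  by apply: map_f; apply: coverL.
have small_le : count (fun n => n <= bound) (index_iota 2 N.+2) <= bound.
  rewrite -size_filter -[leqRHS](size_iota 1).
  apply: uniq_leq_size => [|n]; first by rewrite filter_uniq ?iota_uniq.
  rewrite mem_filter mem_index_iota mem_iota => /and3P[n_le n_gt1 _].
  by rewrite add1n ltnS n_le ltnW.
have exc_le : count exc (index_iota 2 N.+2) <= (N.+1 %/ m).+1 * size L.
  rewrite -(size_map Z.to_nat L); apply: leq_trans (count_residues_le _ _ m_gt0).
  (* The range is padded to complete blocks of length [m] starting at 0. *)
  have N_lt : N.+1 < (N.+1 %/ m).+1 * m by rewrite ltn_ceil.
  have -> : (N.+1 %/ m).+1 * m = 2 + (N.+2 - 2) + ((N.+1 %/ m).+1 * m - N.+2).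
    by lia.
  by rewrite !iotaD !count_cat -addnA addnCA leq_addr.
have := count_predC good (index_iota 2 N.+2).
rewrite size_iota /num_good_bases -/good; lia.
Qed.

Lemma num_good_bases_density bound M L (c d : nat) :
  covers_exceptions bound (M, L) ->
  (Z.of_nat (d * size L) < Z.of_nat c * M)%Z ->
  exists N0, forall N, N0 <= N -> d * N <= d * num_good_bases N + c * N.
Proof.
move=> coverL sparse; have [M_gt0 _] := coverL.
(* Strictness in [sparse] gains at least 1 per block, so this many blocks absorb the constant
   terms. *)
set m := Z.to_nat M; exists (m * (d * (bound + 1) + c * m)) => N N_ge.
have q_ge : d * (bound + 1) + c * m <= N %/ m by rewrite leq_divRL 1?mulnC //; lia.
have := num_good_bases_ge N coverL; rewrite -/m.
have := leq_trunc_div N m.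
have : d * size L < c * m by rewrite /m; lia.
move: (num_good_bases N) (N %/ m) (size L) q_ge => g q s q_ge ds_lt qm_le N_le.
have := leq_mul (leqnn d) N_le; have := leq_mul (leqnn c) qm_le.
have := leq_mul (leqnn q.+1) ds_lt.
clear - q_ge; lia.
Qed.

Lemma limn_einf_ge (R : realType) (u : (\bar R)^nat) (x : \bar R) N0 :
  (forall n, N0 <= n -> (x <= u n)%E) -> (x <= limn_einf u)%E.
Proof.
move=> u_ge; rewrite limn_einf_lim (cvg_lim _ (@cvg_einfs_sup _ u)) //.
apply: (le_trans _ (ereal_sup_ubound _)); last by exists N0.
by apply/ereal_infP => _ [k /= k_ge <-]; exact: u_ge.
Qed.

(** For even [a], [a - 1] and [a + 1] are odd and at most 19, so the common modulus is only the lcm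
    of 1, 3, .., 19. *)
Definition even_factors : seq nat := [:: 2; 4; 6; 8; 10; 12; 14; 16; 18].

Lemma sieve_sparse :
  let: (M, L) := foldl (sieve_step 16) (1%Z, [:: 0%Z]) even_factors in
  (1000 * Z.of_nat (size L) <? 7 * M)%Z.
Proof. by vm_compute. Qed.

Local Open Scope ring_scope.

Theorem proposition7p1 (R : realType) :
  ((993%:R / 1000%:R : R)%:E <=
     limn_einf (fun N : nat => ((num_good_bases N)%:R / N%:R : R)%:E))%E.
Proof.
(* 5832 = 18 ^ 3 *)
have : covers_exceptions 5832 (foldl (sieve_step 16) (1%Z, [:: 0%Z]) even_factors).
  exact: sieve_covers.
move: sieve_sparse; case: (foldl _ _ _) => M L /Z.ltb_lt sparse coverL.
have [|N0 N0P] := @num_good_bases_density _ M L 7 1000 coverL; first by lia.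
(* The maximum with 1 ensures a nonzero denominator. *)
apply: (@limn_einf_ge _ _ _ (maxn N0 1)) => N; rewrite geq_max => /andP[N_ge N_gt0].
rewrite lee_fin ler_pdivlMr ?ltr0n // mulrAC ler_pdivrMr ?ltr0n //.
rewrite -!natrM ler_nat; have := N0P N N_ge; lia.
Qed.
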